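(* There exists a numerical constant $C$ with $1\le C\le 17$ (not depending on the tensors, their order or their dimensions) such that the following holds. Let $p>2$, let $d_1,\dots,d_p\ge 1$ be integers, $d_{\min}=\min\{d_1,\ldots,d_p\}$, and let $\mathscr{T},\tilde{\mathscr{T}}\in\mathbb{R}^{d_1\times\cdots\times d_p}$ be two odeco tensors with decompositions $$\mathscr{T}=\sum_{k=1}^{d_{\min}}\lambda_k\,\mathbf{u}_k^{(1)}\otimes\cdots\otimes\mathbf{u}_k^{(p)},\qquad \tilde{\mathscr{T}}=\sum_{k=1}^{d_{\min}}\tilde\lambda_k\,\tilde{\mathbf{u}}_k^{(1)}\otimes\cdots\otimes\tilde{\mathbf{u}}_k^{(p)},$$ where $\lambda_1\ge\cdots\ge\lambda_{d_{\min}}\ge 0$, $\tilde\lambda_1\ge\cdots\ge\tilde\lambda_{d_{\min}}\ge0$, and for each $q$ the vectors $\mathbf{u}_1^{(q)},\ldots,\mathbf{u}_{d_{\min}}^{(q)}\in\mathbb{R}^{d_q}$ are orthonormal, and likewise $\tilde{\mathbf{u}}_1^{(q)},\ldots,\tilde{\mathbf{u}}_{d_{\min}}^{(q)}\in\mathbb{R}^{d_q}$ are orthonormal. Then there exists a permutation $\pi$ of $\{1,\ldots,d_{\min}\}$ such that for all $k=1,\ldots,d_{\min}$, $$|\lambda_k-\tilde\lambda_{\pi(k)}|\le C\|\tilde{\mathscr{T}}-\mathscr{T}\|$$ and $$\max_{1\le q\le p}\sin\angle(\mathbf{u}_k^{(q)},\tilde{\mathbf{u}}_{\pi(k)}^{(q)})\le\frac{C\|\tilde{\mathscr{T}}-\mathscr{T}\|}{\lambda_k},$$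 with the convention $1/0=+\infty$.
   Context: A tensor $\mathscr{T}\in\mathbb{R}^{d_1\times\cdots\times d_p}$ is odeco (orthogonally decomposable) if it admits a decomposition of the form displayed in the claim. For vectors $\mathbf{u},\mathbf{v}$, $\angle(\mathbf{u},\mathbf{v})\in[0,\pi/2]$ denotes the angle between the lines they span, so for unit vectors $\sin\angle(\mathbf{u},\mathbf{v})=\sqrt{1-\langle\mathbf{u},\mathbf{v}\rangle^2}$. The spectral norm of a tensor $\mathscr{A}\in\mathbb{R}^{d_1\times\cdots\times d_p}$ is $\|\mathscr{A}\|=\max\langle\mathscr{A},\mathbf{x}^{(1)}\otimes\cdots\otimes\mathbf{x}^{(p)}\rangle$, the maximum being over unit vectors $\mathbf{x}^{(q)}\in\mathbb{R}^{d_q}$, where $\langle\cdot,\cdot\rangle$ is the entrywise inner product. When $\lambda_k=0$ the right-hand side of the second inequality is read as $+\infty$, i.e. that inequality imposes nothing. *)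

(* Defs.v *)
From HB Require Import structures.
From mathcomp Require Import all_boot all_order all_algebra all_fingroup.
From mathcomp Require Import all_classical all_reals all_analysis.
From mathcomp Require Import ring lra.

Set Implicit Arguments.
Unset Strict Implicit.
Unset Printing Implicit Defensive.

Import Order.TTheory GRing.Theory Num.Theory.
Import numFieldNormedType.Exports.

Local Open Scope classical_set_scope.
Local Open Scope ring_scope.

(* The minimum of the d q. The big operator needs a starting value; the maximum
   of the d q is neutral for it. *)
Definition dmin (p : nat) (d : 'I_p -> nat) : nat :=
  \big[minn/(\max_(q < p) d q)%N]_(q < p) d q.

(* The Euclidean structure is defined by hand because the library norm `|u| on
   'rV[R]_n is the sup norm. *)
Definition dot (R : realType) (n : nat) (u v : 'rV[R]_n) : R :=
  \sum_(i < n) u 0 i * v 0 i.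

Definition norm2 (R : realType) (n : nat) (u : 'rV[R]_n) : R :=
  Num.sqrt (dot u u).

(* Angle between the lines spanned by u and v: the absolute value puts it in
   [0, pi / 2]. *)
Definition line_angle (R : realType) (n : nat) (u v : 'rV[R]_n) : R :=
  acos (`|dot u v| / (norm2 u * norm2 v)).

Definition orthonormal (R : realType) (m n : nat) (u : 'I_m -> 'rV[R]_n) : Prop :=
  forall k l : 'I_m, dot (u k) (u l) = (k == l)%:R.

(* A multi-index is a tuple (i_1, ..., i_p) with i_q < d q. *)
Definition multi_index (p : nat) (d : 'I_p -> nat) : finType :=
  {dffun forall q : 'I_p, 'I_(d q)}.

Notation tensor R d := {ffun multi_index d -> R}.

Definition outer (R : realType) (p : nat) (d : 'I_p -> nat)
    (x : forall q : 'I_p, 'rV[R]_(d q)) : tensor R d :=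
  [ffun i : multi_index d => \prod_(q < p) x q 0 (i q)].

Definition tdot (R : realType) (p : nat) (d : 'I_p -> nat)
    (A B : tensor R d) : R :=
  \sum_(i : multi_index d) A i * B i.

(* When every d q is positive, the set below is nonempty and compact, so the
   supremum is a maximum. *)
Definition spectral_norm (R : realType) (p : nat) (d : 'I_p -> nat)
    (A : tensor R d) : R :=
  sup [set tdot A (outer x) | x in
        [set x : forall q : 'I_p, 'rV[R]_(d q) | forall q, norm2 (x q) = 1]].

Definition odeco_decomposition (R : realType) (p : nat) (d : 'I_p -> nat)
    (T : tensor R d) (lam : 'I_(dmin d) -> R)
    (u : forall q : 'I_p, 'I_(dmin d) -> 'rV[R]_(d q)) : Prop :=
  [/\ T = \sum_(k < dmin d) lam k *: outer (fun q => u q k),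
      forall k l : 'I_(dmin d), (k <= l)%N -> lam l <= lam k,
      forall k : 'I_(dmin d), 0 <= lam k
    & forall q : 'I_p, orthonormal (u q)].

Lemma sin_line_angle (R : realType) (n : nat) (u v : 'rV[R]_n) :
  norm2 u = 1 -> norm2 v = 1 ->
  sin (line_angle u v) = Num.sqrt (1 - dot u v ^+ 2).
Proof.
move=> u1 v1.
have d1 (w : 'rV[R]_n) : norm2 w = 1 -> dot w w = 1.
  move=> w1; have w0 : 0 <= dot w w.
    by apply: sumr_ge0 => i _; rewrite -expr2 sqr_ge0.
  by rewrite -(sqr_sqrtr w0) -/(norm2 w) w1 expr1n.
have sq (e : R) : e ^+ 2 = 1 -> 0 <= 1 + e * dot u v.
  move=> e1; suff : 0 <= (1 + e * dot u v) *+ 2 by rewrite pmulrn_lge0.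
  have -> : (1 + e * dot u v) *+ 2 = \sum_(i < n) (u 0 i + e * v 0 i) ^+ 2.
    have -> : (1 + e * dot u v) *+ 2
        = dot u u + 2 * e * dot u v + e ^+ 2 * dot v v.
      by rewrite !d1 // e1; ring.
    rewrite /dot !mulr_sumr -!big_split /=; apply: eq_bigr => i _.
    ring.
  by apply: sumr_ge0 => i _; rewrite sqr_ge0.
rewrite /line_angle u1 v1 mulr1 divr1 sin_acos ?real_normK ?num_real //.
have h1 := sq 1 (expr1n _ _); have h2 := sq (-1) (etrans (sqrrN 1) (expr1n _ _)).
have := normr_ge0 (dot u v).
have : `|dot u v| <= 1 by rewrite ler_norml; apply/andP; split; lra.
by move=> ? ?; apply/andP; split; lra.
Qed.

(* Main.v *)
(* Let e be the spectral norm of T' - T and x_q = |<u_k^(q), u'_l^(q)>|. Testing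
   T' - T on u_k in all modes but q and on u'_l in mode q, and vice versa, gives
   lam_k x_q <= lam'_l prod_(r != q) x_r + e and the same with lam_k, lam'_l
   exchanged. As p > 2 this forces, for m = max(lam_k, lam'_l) > 8 e, that either
   every x_q is at most 2 e / m or every x_q is at least 1 - 2 e / m; in the second
   case k and l are called aligned. Alignment is a partial matching by Bessel's
   inequality. If w is a unit vector orthogonal to the u'_l^(q) with l aligned with
   k, testing T' - T on u_k in all modes but q and on w in mode q yields
   lam_k |<u_k^(q), w>| <= 3 e. With w = u_k^(q) this shows that every k with
   lam_k > 8 e is aligned with some l; with w the normalized component of u_k^(q)
   orthogonal to u'_l^(q) it bounds the sine. Any permutation extending the
   matching works, with C = 8. *)

Require Import Defs.
From HB Require Import structures.
From mathcomp Require Import all_boot all_order all_algebra all_fingroup.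
From mathcomp Require Import all_classical all_reals all_analysis.
From mathcomp Require Import ring lra.

Set Implicit Arguments.
Unset Strict Implicit.
Unset Printing Implicit Defensive.

Import Order.TTheory GRing.Theory Num.Theory.
Import numFieldNormedType.Exports.

Local Open Scope ring_scope.

(** * Distributivity over dependent functions, and extension of partial injections *)

(** Embedding every [J i] in the type of tagged pairs makes distributivity for ordinary functions
    apply; [fprod] carries the result back to dependent ones. *)
Lemma prod_sum_dffun (R : comNzRingType) (I : finType) (J : I -> finType)
    (F : forall i, J i -> R) :
  \prod_i \sum_(j : J i) F i j
    = \sum_(f : {dffun forall i, J i}) \prod_i F i (f i).
Proof.
pose G i := finfun (F i).
have tag i : \sum_(j : J i) F i j
    = \sum_(t in tagged_with J i) untag 0 (G i) t.
  transitivity (\sum_(j in @predT (J i)) G i j).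
    by apply: eq_bigr => j _; rewrite ffunE.
  rewrite (@big_tag_cond R 0 +%R I J (fun i => @predT (J i)) G).
  by apply: eq_bigl => t; rewrite /untag; case: eqP => [e|_]; rewrite ?inE ?andbT.
under eq_bigr do rewrite tag.
rewrite bigA_distr_big_dep -(@big_fprod R 0 1 *%R +%R I J G).
rewrite (reindex (@fprod_of_dffun I J)) /=; last exact/onW_bij/fprod_of_dffun_bij.
by apply: eq_bigr => f _; apply: eq_bigr => i _; rewrite ffunE fprodE.
Qed.

(** The lists [a] ([D], then its complement) and [b] (the image of [D], then its complement) both
    enumerate [T]; the permutation sends each entry of [a] to the entry of [b] at the same
    position. *)
Lemma perm_extension (T : finType) (D : {set T}) (f : T -> T) :
  {in D &, injective f} ->
  exists s : {perm T}, {in D, s =1 f}.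
Proof.
move=> injf.
pose a := enum D ++ enum (~: D); pose b := map f (enum D) ++ enum (~: (f @: D)).
have ua : uniq a.
  rewrite cat_uniq !enum_uniq andbT /=; apply/hasPn => x.
  by rewrite !mem_enum inE.
have ub : uniq b.
  rewrite cat_uniq enum_uniq andbT map_inj_in_uniq ?enum_uniq /=; last first.
    by move=> x y; rewrite !mem_enum; apply: injf.
  apply/hasPn => x; rewrite mem_enum inE; apply: contra => /mapP[y].
  by rewrite mem_enum => yD ->; apply: imset_f.
have sab : size a = size b.
  rewrite !size_cat size_map -!cardE; congr addn.
  by rewrite [LHS]cardsCs [RHS]cardsCs !finset.setCK card_in_imset.
have ina x : x \in a by rewrite mem_cat !mem_enum inE orbN.
pose g x := nth x b (index x a).
have injg : injective g.
  move=> x y; rewrite /g (set_nth_default x y) -?sab ?index_mem // => /eqP.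
  rewrite nth_uniq -?sab ?index_mem // => /eqP E.
  by rewrite -(nth_index x (ina x)) E nth_index.
exists (perm injg) => x xD; rewrite permE /g index_cat mem_enum xD.
rewrite nth_cat size_map index_mem mem_enum xD (nth_map x) ?index_mem ?mem_enum //.
by rewrite nth_index ?mem_enum.
Qed.

(** * Euclidean inner product and Bessel's inequality *)

Lemma dotC (R : realType) (n : nat) (u v : 'rV[R]_n) : dot u v = dot v u.
Proof. by apply: eq_bigr => i _; rewrite mulrC. Qed.

Lemma dotDl (R : realType) (n : nat) (u v w : 'rV[R]_n) :
  dot (u + v) w = dot u w + dot v w.
Proof. by rewrite -big_split; apply: eq_bigr => i _; rewrite mxE mulrDl. Qed.

Lemma dotZl (R : realType) (n : nat) (a : R) (u v : 'rV[R]_n) :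
  dot (a *: u) v = a * dot u v.
Proof. by rewrite mulr_sumr; apply: eq_bigr => i _; rewrite mxE mulrA. Qed.

Lemma dotNl (R : realType) (n : nat) (u v : 'rV[R]_n) : dot (- u) v = - dot u v.
Proof. by rewrite -scaleN1r dotZl mulN1r. Qed.

Lemma dot_suml (R : realType) (n : nat) (I : finType) (u : I -> 'rV[R]_n)
    (v : 'rV[R]_n) :
  dot (\sum_i u i) v = \sum_i dot (u i) v.
Proof.
rewrite /dot exchange_big; apply: eq_bigr => j _.
by rewrite summxE mulr_suml.
Qed.

Lemma dot_ge0 (R : realType) (n : nat) (u : 'rV[R]_n) : 0 <= dot u u.
Proof. by apply: sumr_ge0 => i _; rewrite -expr2 sqr_ge0. Qed.

Lemma norm2_eq1 (R : realType) (n : nat) (u : 'rV[R]_n) :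
  dot u u = 1 <-> norm2 u = 1.
Proof.
rewrite /norm2; split=> [->|h]; first exact: sqrtr1.
by rewrite -(sqr_sqrtr (dot_ge0 u)) h expr1n.
Qed.

Lemma bessel (R : realType) (m n : nat) (u : 'I_m -> 'rV[R]_n) (w : 'rV[R]_n) :
  Defs.orthonormal u -> \sum_k dot (u k) w ^+ 2 <= dot w w.
Proof.
move=> ou; pose v := \sum_k dot (u k) w *: u k.
have vw : dot v w = \sum_k dot (u k) w ^+ 2.
  by rewrite dot_suml; apply: eq_bigr => k _; rewrite dotZl expr2.
have vv : dot v v = dot v w.
  rewrite vw dot_suml; apply: eq_bigr => k _; rewrite dotZl expr2; congr (_ * _).
  rewrite dotC dot_suml (bigD1 k) //= dotZl ou eqxx mulr1 big1 ?addr0 // => l lk.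
  by rewrite dotZl ou (negPf lk) mulr0.
have := dot_ge0 (w - v).
by rewrite dotDl dotNl !(dotC _ (w - v)) !dotDl !dotNl vv (dotC w v) vw; lra.
Qed.

(** Termwise a * b <= (a^2 + b^2) / 2, then Bessel's inequality for each family. *)
Lemma sum_norm_dot_le1 (R : realType) (m n n' : nat) (u : 'I_m -> 'rV[R]_n)
    (v : 'I_m -> 'rV[R]_n') (x : 'rV[R]_n) (y : 'rV[R]_n') :
  Defs.orthonormal u -> Defs.orthonormal v -> dot x x = 1 -> dot y y = 1 ->
  \sum_k `|dot (u k) x| * `|dot (v k) y| <= 1.
Proof.
move=> ou ov x1 y1; have := bessel x ou; have := bessel y ov; rewrite x1 y1.
suff : \sum_k `|dot (u k) x| * `|dot (v k) y|
    <= \sum_k 2^-1 * (dot (u k) x ^+ 2 + dot (v k) y ^+ 2).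
  by rewrite -mulr_sumr big_split /=; lra.
apply: ler_sum => k _; rewrite -[dot (u k) x ^+ 2]real_normK ?num_real //.
rewrite -[dot (v k) y ^+ 2]real_normK ?num_real //.
by have := sqr_ge0 (`|dot (u k) x| - `|dot (v k) y|); rewrite sqrrB; lra.
Qed.

Lemma norm_dot_le1 (R : realType) (n : nat) (x y : 'rV[R]_n) :
  dot x x = 1 -> dot y y = 1 -> `|dot x y| <= 1.
Proof.
move=> x1 y1; have ox : Defs.orthonormal (fun _ : 'I_1 => x).
  by move=> k l; rewrite x1 !ord1 eqxx.
have := bessel y ox; rewrite big_ord1 y1 -[_ ^+ 2]real_normK ?num_real //.
by rewrite expr_le1 // normr_ge0.
Qed.

(** * Pairing with rank-one tensors, and the spectral norm *)

Lemma tdot_outer (R : realType) (p : nat) (d : 'I_p -> nat)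
    (x y : forall q, 'rV[R]_(d q)) :
  tdot (outer x) (outer y) = \prod_q dot (x q) (y q).
Proof.
rewrite prod_sum_dffun; apply: eq_bigr => i _.
by rewrite !ffunE -big_split.
Qed.

Lemma tdot_sum_outer (R : realType) (p n : nat) (d : 'I_p -> nat)
    (lam : 'I_n -> R) (u : forall q, 'I_n -> 'rV[R]_(d q))
    (x : forall q, 'rV[R]_(d q)) :
  tdot (\sum_k lam k *: outer (fun q => u q k)) (outer x)
    = \sum_k lam k * \prod_q dot (u q k) (x q).
Proof.
rewrite /tdot; under eq_bigr do rewrite sum_ffunE mulr_suml.
rewrite exchange_big; apply: eq_bigr => k _; rewrite -tdot_outer mulr_sumr.
by apply: eq_bigr => i _; rewrite ffunE -mulrA.
Qed.

Lemma tdotBl (R : realType) (p : nat) (d : 'I_p -> nat) (A B C : tensor R d) :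
  tdot (A - B) C = tdot A C - tdot B C.
Proof.
by rewrite -sumrB; apply: eq_bigr => i _; rewrite !ffunE mulrBl.
Qed.

Lemma prod_dfwith (R : comNzRingType) (I : finType) (V : I -> Type)
    (F : forall i, V i -> R) (x : forall i, V i) (i : I) (w : V i) :
  \prod_j F j (dfwith x _ w j) = F i w * \prod_(j | j != i) F j (x j).
Proof.
rewrite (bigD1 i) //= dfwithin; congr (_ * _); apply: eq_bigr => j ji.
by rewrite dfwithout // eq_sym.
Qed.

Lemma unit_dfwith (R : realType) (p : nat) (d : 'I_p -> nat)
    (x : forall q, 'rV[R]_(d q)) (q : 'I_p) (w : 'rV[R]_(d q)) :
  (forall r, dot (x r) (x r) = 1) -> dot w w = 1 ->
  forall r, dot (dfwith x _ w r) (dfwith x _ w r) = 1.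
Proof.
by move=> x1 w1 r; case: dfwithP.
Qed.

Lemma norm_tdot_outer_le (R : realType) (p : nat) (d : 'I_p -> nat)
    (A : tensor R d) (x : forall q, 'rV[R]_(d q)) :
  (0 < p)%N -> (forall q, dot (x q) (x q) = 1) ->
  `|tdot A (outer x)| <= spectral_norm A.
Proof.
move=> p0 x1.
(* Entries of unit vectors are at most 1 in absolute value, so the set defining the supremum is
   bounded by the sum of the [|A i|]. *)
have le1 (y : forall q, 'rV[R]_(d q)) q i : dot (y q) (y q) = 1 -> `|y q 0 i| <= 1.
  rewrite /dot (bigD1 i) //= => y1; rewrite -(@expr_le1 _ 2) ?normr_ge0 //.
  rewrite real_normK ?num_real // -y1 expr2 lerDl.
  by apply: sumr_ge0 => j _; rewrite -expr2 sqr_ge0.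
have ub (y : forall q, 'rV[R]_(d q)) : (forall q, dot (y q) (y q) = 1) ->
    tdot A (outer y) <= spectral_norm A.
  move=> y1; apply: sup_upper_bound; last first.
    by exists y => // q; apply/norm2_eq1.
  split; first by exists (tdot A (outer y)), y => // q; apply/norm2_eq1.
  exists (\sum_i `|A i|) => _ [z z1 <-]; apply: ler_sum => i _.
  apply: le_trans (ler_norm _) _; rewrite normrM ler_piMr // ffunE normr_prod.
  apply: prodr_ile1 => q _; rewrite normr_ge0 le1 //.
  exact/norm2_eq1.
rewrite ler_norml ub // andbT lerNl.
(* Negating a single factor negates the pairing, which turns the upper bound into a lower one. *)
have e : tdot A (outer (dfwith x _ (- x (Ordinal p0)))) = - tdot A (outer x).
  rewrite /tdot -sumrN; apply: eq_bigr => i _.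
  rewrite !ffunE (prod_dfwith (fun q (v : 'rV[R]_(d q)) => v 0 (i q))).
  by rewrite [in RHS](bigD1 (Ordinal p0)) //= mxE; ring.
rewrite -e ub //; apply: unit_dfwith => //.
by rewrite dotNl dotC dotNl opprK.
Qed.

(** * The scalar dichotomy *)

Lemma third_ord (p : nat) (q r : 'I_p) :
  (2 < p)%N -> exists2 t, t != q & t != r.
Proof.
move=> p2; have /subsetPn[t _] : ~~ ([set: 'I_p] \subset [set q; r]%SET).
  apply/negP => /subset_leq_card; rewrite cardsT card_ord cards2.
  by rewrite leqNgt (leq_ltn_trans _ p2) //; case: (q != r).
by rewrite !inE negb_or => /andP[tq tr]; exists t.
Qed.

Lemma prod_le_mul2 (R : realType) (p : nat) (x : 'I_p -> R) (q r t : 'I_p) :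
  (forall s, 0 <= x s <= 1) -> r != q -> t != q -> t != r ->
  \prod_(s | s != q) x s <= x r * x t.
Proof.
move=> x01 rq tq tr; have x0 s : 0 <= x s by case/andP: (x01 s).
rewrite (bigD1 r) //= (bigD1 t) ?tq //= mulrA.
by rewrite ler_piMr ?mulr_ge0 // prodr_ile1.
Qed.

(* Let X be the largest x q. Since p > 2, the product omitting that index
   is at most X * x r for every other r, so m * X * (1 - x r) <= e: either
   X <= 1/2, and then m * X <= 2 e, or every 1 - x r is at most 2 e / m. *)
Lemma all_small_or_all_near1 (R : realType) (p : nat) (x : 'I_p -> R) (m e : R) :
  (2 < p)%N -> 0 <= m -> (forall q, 0 <= x q <= 1) ->
  (forall q, m * x q <= m * \prod_(r | r != q) x r + e) ->
  (forall q, m * x q <= 2 * e) \/ (forall q, m * (1 - x q) <= 2 * e).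
Proof.
move=> p2 m0 x01 hx.
have q0 : 'I_p by exists 0%N; apply: ltn_trans p2.
case: (arg_maxP x (isT : predT q0)) => q _ /= xmax.
have xq r : x r <= x q by apply: xmax.
have x0 r : 0 <= x r by case/andP: (x01 r).
have neq r : r != q -> m * x q * (1 - x r) <= e.
  move=> rq; have [t tq tr] := third_ord q r p2.
  have := ler_wpM2l m0 (prod_le_mul2 x01 rq tq tr).
  have := ler_wpM2l m0 (ler_wpM2l (x0 r) (xq t)).
  by have := hx q; nra.
(* For r = q the bound passes to another index t, since 1 - x q <= 1 - x t by maximality of x q. *)
have all_r r : m * x q * (1 - x r) <= e.
  case: (eqVneq r q) => [->|]; last exact: neq.
  have [t tq _] := third_ord q q p2.
  apply: le_trans (neq t tq); rewrite ler_wpM2l ?mulr_ge0 //.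
  by rewrite lerD2l lerN2.
case: (lerP (x q) (1 / 2)) => hq; [left | right] => r.
  have := ler_wpM2l m0 (xq r); have := all_r q.
  by have := mulr_ge0 (mulr_ge0 m0 (x0 q)) (_ : 0 <= 1/2 - x q); nra.
have /andP[_ x1] := x01 r; have := all_r r.
by have : 0 <= m * (1 - x r) * (x q - 1/2); [rewrite !mulr_ge0 //; lra | nra].
Qed.

(** * Contractions of the difference tensor *)

(* The quantity bounded by e is T' - T evaluated at u_k in all modes but q and at
   w in mode q. *)
Definition contractions_close (R : realType) (p n : nat) (d : 'I_p -> nat)
    (lam lam' : 'I_n -> R) (u u' : forall q, 'I_n -> 'rV[R]_(d q)) (e : R) :=
  forall (k : 'I_n) (q : 'I_p) (w : 'rV[R]_(d q)), dot w w = 1 ->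
  `|\sum_l lam' l * (dot (u' q l) w * \prod_(r | r != q) dot (u' r l) (u r k))
    - lam k * dot (u q k) w| <= e.

Lemma contractions_closeP (R : realType) (p n : nat) (d : 'I_p -> nat)
    (T T' : tensor R d) (lam lam' : 'I_n -> R)
    (u u' : forall q, 'I_n -> 'rV[R]_(d q)) (e : R) :
  (1 < p)%N -> (forall q, Defs.orthonormal (u q)) ->
  T = \sum_k lam k *: outer (fun q => u q k) ->
  T' = \sum_k lam' k *: outer (fun q => u' q k) ->
  (forall x, (forall q, dot (x q) (x q) = 1) -> `|tdot (T' - T) (outer x)| <= e) ->
  contractions_close lam lam' u u' e.
Proof.
move=> p1 ou -> -> close k q w w1.
have := close (dfwith (fun r => u r k) _ w).
rewrite tdotBl !tdot_sum_outer.
under [X in X - _]eq_bigr do rewrite (prod_dfwith (fun r => dot (u' r _))).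
under [X in _ - X]eq_bigr do rewrite (prod_dfwith (fun r => dot (u r _))).
rewrite [X in _ - X](bigD1 k) //= [X in _ * (_ * X)]big1; last first.
  by move=> r _; rewrite ou eqxx.
(* A term with l != k has a vanishing factor in some mode r != q, which exists because p > 1. *)
rewrite [X in _ - (_ + X)]big1 ?mulr1 ?addr0; last first.
  move=> l lk; have [r rq] : exists r, r != q.
    have /subsetPn[r _] : ~~ ([set: 'I_p] \subset [set q]%SET).
      apply/negP => /subset_leq_card.
      by rewrite cardsT card_ord cards1 leqNgt p1.
    by rewrite inE; exists r.
  by rewrite (bigD1 r) //= ou (negPf lk) mul0r !mulr0.
by apply; apply: unit_dfwith => // r; rewrite ou eqxx.
Qed.

(** * Alignment of components *)

(** For m > 8 e >= 0 one has 2 e / m < 1/4, so the threshold 3/4 separates the two cases of the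
    dichotomy. *)
Definition aligned (R : realType) (p n : nat) (d : 'I_p -> nat)
    (u u' : forall q, 'I_n -> 'rV[R]_(d q)) (k l : 'I_n) : bool :=
  [forall q, 3 / 4 <= `|dot (u q k) (u' q l)|].

Lemma alignedC (R : realType) (p n : nat) (d : 'I_p -> nat)
    (u u' : forall q, 'I_n -> 'rV[R]_(d q)) (k l : 'I_n) :
  aligned u u' k l = aligned u' u l k.
Proof. by apply: eq_forallb => q; rewrite dotC. Qed.

(** Two distinct partners would contribute at least 2 * (3/4)^2 = 9/8 > 1 to Bessel's sum. *)
Lemma aligned_inj (R : realType) (p n : nat) (d : 'I_p -> nat)
    (u u' : forall q, 'I_n -> 'rV[R]_(d q)) (k l m : 'I_n) :
  (0 < p)%N -> (forall q, Defs.orthonormal (u q)) ->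
  (forall q, Defs.orthonormal (u' q)) ->
  aligned u u' k l -> aligned u u' k m -> l = m.
Proof.
move=> p0 ou ou' /forallP/(_ (Ordinal p0)) + /forallP/(_ (Ordinal p0)).
set q := Ordinal p0 => kl km; apply: contraTeq isT => lm.
have := bessel (u q k) (ou' q); rewrite ou eqxx.
rewrite (bigD1 l) //= (bigD1 m) 1?eq_sym //= !(dotC _ (u q k)).
have : 0 <= \sum_(i < n | (i != l) && (i != m)) dot (u' q i) (u q k) ^+ 2.
  by apply: sumr_ge0 => i _; rewrite sqr_ge0.
rewrite -[dot (u q k) (u' q l) ^+ 2]real_normK ?num_real //.
rewrite -[dot (u q k) (u' q m) ^+ 2]real_normK ?num_real //.
by nra.
Qed.

(** For w = [u' q l], orthonormality leaves only the term of index l in the contraction. *)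
Lemma contraction_cross (R : realType) (p n : nat) (d : 'I_p -> nat)
    (lam lam' : 'I_n -> R) (u u' : forall q, 'I_n -> 'rV[R]_(d q)) (e : R) :
  contractions_close lam lam' u u' e ->
  (forall q, Defs.orthonormal (u' q)) -> (forall k, 0 <= lam k) ->
  (forall l, 0 <= lam' l) ->
  forall k l q, lam k * `|dot (u q k) (u' q l)|
    <= lam' l * \prod_(r | r != q) `|dot (u r k) (u' r l)| + e.
Proof.
move=> close ou' lam0 lam'0 k l q; have := close k q (u' q l).
rewrite ou' eqxx => /(_ erefl).
rewrite (bigD1 l) //= ou' eqxx mul1r [X in _ + X - _]big1 ?addr0; last first.
  by move=> m ml; rewrite ou' (negPf ml) mul0r mulr0.
under [X in lam' l * X]eq_bigr do rewrite dotC.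
move=> /(le_trans (ler_dist_dist _ _)); rewrite !normrM normr_prod.
by rewrite (ger0_norm (lam'0 l)) (ger0_norm (lam0 k)) ler_norml => /andP[]; lra.
Qed.

(** The index argument supplies a test vector; for n = 0 closeness is vacuous and e could be
    negative. *)
Lemma close_ge0 (R : realType) (p n : nat) (d : 'I_p -> nat)
    (lam lam' : 'I_n -> R) (u u' : forall q, 'I_n -> 'rV[R]_(d q)) (e : R) :
  contractions_close lam lam' u u' e -> (0 < p)%N ->
  (forall q, Defs.orthonormal (u q)) -> 'I_n -> 0 <= e.
Proof.
move=> close p0 ou k; apply: le_trans (close k (Ordinal p0) (u _ k) _) => //.
by rewrite ou eqxx.
Qed.

Lemma aligned_dichotomy (R : realType) (p n : nat) (d : 'I_p -> nat)
    (lam lam' : 'I_n -> R) (u u' : forall q, 'I_n -> 'rV[R]_(d q)) (e : R) :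
  (2 < p)%N -> contractions_close lam lam' u u' e ->
  contractions_close lam' lam u' u e ->
  (forall q, Defs.orthonormal (u q)) -> (forall q, Defs.orthonormal (u' q)) ->
  (forall k, 0 <= lam k) -> (forall l, 0 <= lam' l) ->
  forall k l, 8 * e < Num.max (lam k) (lam' l) ->
  if aligned u u' k l
  then forall q, Num.max (lam k) (lam' l) * (1 - `|dot (u q k) (u' q l)|) <= 2 * e
  else forall q, Num.max (lam k) (lam' l) * `|dot (u q k) (u' q l)| <= 2 * e.
Proof.
move=> p2 close close' ou ou' lam0 lam'0 k l.
set m := Num.max _ _ => me.
have p0 : (0 < p)%N by apply: ltn_trans p2.
have e0 := close_ge0 close p0 ou k.
pose x q := `|dot (u q k) (u' q l)|.
have x01 q : 0 <= x q <= 1.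
  by rewrite normr_ge0 norm_dot_le1 ?ou ?ou' ?eqxx.
have m0 : 0 <= m by rewrite le_max lam0.
have km : lam k <= m by rewrite le_max lexx.
have lm : lam' l <= m by rewrite le_max lexx orbT.
have P0 q : 0 <= \prod_(r | r != q) x r.
  by apply: prodr_ge0 => r _; case/andP: (x01 r).
(* Of the two cross inequalities, the one with the larger coefficient on its left is used; its right
   coefficient is then raised to m. *)
have hx q : m * x q <= m * \prod_(r | r != q) x r + e.
  rewrite {1}/m; case: (leP (lam k) (lam' l)) => _.
    have := contraction_cross close' ou lam'0 lam0 l k q.
    rewrite dotC; under eq_bigr do rewrite dotC.
    by move=> /le_trans; apply; rewrite lerD2r ler_wpM2r.
  apply: le_trans (contraction_cross close ou' lam0 lam'0 k l q) _.
  by rewrite lerD2r ler_wpM2r.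
(* The mixed cases contradict m > 8 e: they would give 3/4 * m <= 2 e, or m / 4 < 2 e. *)
case: (all_small_or_all_near1 p2 m0 x01 hx) => hm; case: ifP => // /forallP al.
  have := hm (Ordinal p0); have := ler_wpM2l m0 (al (Ordinal p0)).
  by rewrite /x; lra.
case: al => q; have := hm q; rewrite -/(x q) => hq.
by rewrite leNgt; apply/negP => xq; nra.
Qed.

(* Only indices l not aligned with k contribute to the contraction, and for
   those each factor lam' l * `|dot (u r k) (u' r l)| is at most 2 e. *)
Lemma unaligned_component (R : realType) (p n : nat) (d : 'I_p -> nat)
    (lam lam' : 'I_n -> R) (u u' : forall q, 'I_n -> 'rV[R]_(d q)) (e : R) :
  (2 < p)%N -> contractions_close lam lam' u u' e ->
  contractions_close lam' lam u' u e ->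
  (forall q, Defs.orthonormal (u q)) -> (forall q, Defs.orthonormal (u' q)) ->
  (forall k, 0 <= lam k) -> (forall l, 0 <= lam' l) ->
  forall k q (w : 'rV[R]_(d q)), 8 * e < lam k -> dot w w = 1 ->
  (forall l, aligned u u' k l -> dot (u' q l) w = 0) ->
  lam k * `|dot (u q k) w| <= 3 * e.
Proof.
move=> p2 close close' ou ou' lam0 lam'0 k q w ke w1 alw.
have p0 : (0 < p)%N by apply: ltn_trans p2.
have e0 := close_ge0 close p0 ou k.
have [r rq _] := third_ord q q p2; have [t tq tr] := third_ord q r p2.
set S := \sum_l lam' l * (dot (u' q l) w * \prod_(r | r != q) dot (u' r l) (u r k)).
suff S2 : `|S| <= 2 * e.
  have := close k q w w1; rewrite -/S distrC => /(le_trans (lerB_dist _ _)).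
  by rewrite normrM (ger0_norm (lam0 k)); lra.
apply: le_trans (ler_norm_sum _ _ _) _.
(* Here p > 2 enters: mode t absorbs [lam' l] into 2 e, while modes q and r together form a sum at
   most 1. *)
suff : \sum_l `|lam' l * (dot (u' q l) w * \prod_(r | r != q) dot (u' r l) (u r k))|
    <= 2 * e * \sum_l `|dot (u' q l) w| * `|dot (u' r l) (u r k)|.
  move=> /le_trans; apply; rewrite ler_piMr ?mulr_ge0 //.
  by apply: sum_norm_dot_le1; rewrite ?ou ?eqxx.
rewrite mulr_sumr; apply: ler_sum => l _.
rewrite !normrM normr_prod (ger0_norm (lam'0 l)).
have [al|nal] := boolP (aligned u u' k l).
  by rewrite alw // normr0 !mul0r !mulr0.
have x01 s : 0 <= `|dot (u' s l) (u s k)| <= 1.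
  by rewrite normr_ge0 norm_dot_le1 ?ou ?ou' ?eqxx.
have /= hP := prod_le_mul2 x01 rq tq tr.
have hm : 8 * e < Num.max (lam k) (lam' l) by rewrite lt_max ke.
have := aligned_dichotomy p2 close close' ou ou' lam0 lam'0 hm.
rewrite (negPf nal) => /(_ t); rewrite dotC => ht.
have {}ht : lam' l * `|dot (u' t l) (u t k)| <= 2 * e.
  apply: le_trans ht; rewrite ler_wpM2r ?normr_ge0 //.
  by rewrite le_max lexx orbT.
rewrite mulrCA [leRHS]mulrCA; apply: ler_wpM2l; rewrite ?normr_ge0 //.
apply: le_trans (ler_wpM2l (lam'0 l) hP) _.
by rewrite mulrCA mulrC; apply: ler_wpM2r; rewrite ?normr_ge0.
Qed.

(** * Existence of partners, and bounds for aligned pairs *)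

(** Without a partner the orthogonality condition on w is vacuous, and w = u_k gives lam k <= 3 e,
    against lam k > 8 e. *)
Lemma exists_aligned (R : realType) (p n : nat) (d : 'I_p -> nat)
    (lam lam' : 'I_n -> R) (u u' : forall q, 'I_n -> 'rV[R]_(d q)) (e : R) :
  (2 < p)%N -> contractions_close lam lam' u u' e ->
  contractions_close lam' lam u' u e ->
  (forall q, Defs.orthonormal (u q)) -> (forall q, Defs.orthonormal (u' q)) ->
  (forall k, 0 <= lam k) -> (forall l, 0 <= lam' l) ->
  forall k, 8 * e < lam k -> exists l, aligned u u' k l.
Proof.
move=> p2 close close' ou ou' lam0 lam'0 k ke.
have p0 : (0 < p)%N by apply: ltn_trans p2.
have e0 := close_ge0 close p0 ou k.
case: (pickP (aligned u u' k)) => [l kl|none]; first by exists l.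
have u1 : dot (u (Ordinal p0) k) (u (Ordinal p0) k) = 1 by rewrite ou eqxx.
have := unaligned_component p2 close close' ou ou' lam0 lam'0 ke u1.
have nal l : aligned u u' k l -> dot (u' (Ordinal p0) l) (u (Ordinal p0) k) = 0.
  by rewrite none.
by rewrite u1 normr1 mulr1 => /(_ nal); lra.
Qed.

(** With x = |<u_k, u'_l>| in one mode, write lam k - lam' l = lam k * (1 - x) + (lam k * x - lam'
    l): the dichotomy bounds the first term by 2 e, the cross inequality the second by e. *)
Lemma aligned_lam_sub (R : realType) (p n : nat) (d : 'I_p -> nat)
    (lam lam' : 'I_n -> R) (u u' : forall q, 'I_n -> 'rV[R]_(d q)) (e : R) :
  (2 < p)%N -> contractions_close lam lam' u u' e ->
  contractions_close lam' lam u' u e ->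
  (forall q, Defs.orthonormal (u q)) -> (forall q, Defs.orthonormal (u' q)) ->
  (forall k, 0 <= lam k) -> (forall l, 0 <= lam' l) ->
  forall k l, aligned u u' k l -> 8 * e < Num.max (lam k) (lam' l) ->
  lam k - lam' l <= 3 * e.
Proof.
move=> p2 close close' ou ou' lam0 lam'0 k l kl hm.
pose q : 'I_p := Ordinal (ltn_trans (isT : 0 < 2)%N p2).
have := aligned_dichotomy p2 close close' ou ou' lam0 lam'0 hm.
rewrite kl => /(_ q).
have x1 s : `|dot (u s k) (u' s l)| <= 1 by rewrite norm_dot_le1 ?ou ?ou' ?eqxx.
have km : lam k <= Num.max (lam k) (lam' l) by rewrite le_max lexx.
have := ler_wpM2r (_ : 0 <= 1 - `|dot (u q k) (u' q l)|) km.
rewrite subr_ge0 => /(_ (x1 q)).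
have := contraction_cross close ou' lam0 lam'0 k l q.
have P1 : \prod_(r | r != q) `|dot (u r k) (u' r l)| <= 1.
  by apply: prodr_ile1 => r _; rewrite normr_ge0 x1.
by have := ler_wpM2l (lam'0 l) P1; lra.
Qed.

(** The dichotomy alone would bound the sine only by the order of sqrt (e / m). The linear bound
    comes from the unit vector w = v / s, whose inner product with [u q k] is the sine s. *)
Lemma aligned_sin (R : realType) (p n : nat) (d : 'I_p -> nat)
    (lam lam' : 'I_n -> R) (u u' : forall q, 'I_n -> 'rV[R]_(d q)) (e : R) :
  (2 < p)%N -> contractions_close lam lam' u u' e ->
  contractions_close lam' lam u' u e ->
  (forall q, Defs.orthonormal (u q)) -> (forall q, Defs.orthonormal (u' q)) ->
  (forall k, 0 <= lam k) -> (forall l, 0 <= lam' l) ->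
  forall k l q, aligned u u' k l -> 8 * e < lam k ->
  lam k * Num.sqrt (1 - dot (u q k) (u' q l) ^+ 2) <= 3 * e.
Proof.
move=> p2 close close' ou ou' lam0 lam'0 k l q kl ke.
have p0 : (0 < p)%N by apply: ltn_trans p2.
have e0 := close_ge0 close p0 ou k.
set c := dot (u q k) (u' q l); set s := Num.sqrt _.
have [s0|s_gt0] := leP s 0.
  by apply: le_trans (_ : 0 <= _); [rewrite mulr_ge0_le0 | lra].
have s2 : s ^+ 2 = 1 - c ^+ 2 by rewrite sqr_sqrtr // ltW // -sqrtr_gt0.
have s_neq0 : s != 0 by rewrite gt_eqF.
pose v := u q k - c *: u' q l.
have dotv (x : 'rV[R]_(d q)) : dot x v = dot x (u q k) - c * dot x (u' q l).
  by rewrite dotC dotDl dotNl dotZl !(dotC _ x).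
have uv : dot (u q k) v = s ^+ 2.
  by rewrite dotv ou eqxx s2 -/c expr2.
have u'v : dot (u' q l) v = 0.
  by rewrite dotv ou' eqxx dotC -/c mulr1 subrr.
have vv : dot v v = s ^+ 2.
  by rewrite dotv !(dotC v) uv u'v mulr0 subr0.
have w1 : dot (s^-1 *: v) (s^-1 *: v) = 1.
  by rewrite dotZl dotC dotZl vv; field.
(* The partner being unique, orthogonality to [u' q l] covers every index aligned with k. *)
have alw m : aligned u u' k m -> dot (u' q m) (s^-1 *: v) = 0.
  move=> km; rewrite -(aligned_inj p0 ou ou' kl km) dotC dotZl dotC u'v.
  by rewrite mulr0.
have := unaligned_component p2 close close' ou ou' lam0 lam'0 ke w1 alw.
rewrite [dot (u q k) _]dotC dotZl dotC uv.
by rewrite expr2 mulKf // ger0_norm // ltW.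
Qed.

(** * The permutation and the final bounds *)

Theorem theorem2p4 (R : realType) :
  exists C : R, 1 <= C <= 17 /\
  forall (p : nat) (d : 'I_p -> nat) (T T' : tensor R d)
    (lam lam' : 'I_(dmin d) -> R)
    (u u' : forall q : 'I_p, 'I_(dmin d) -> 'rV[R]_(d q)),
  (2 < p)%N ->
  (forall q : 'I_p, (1 <= d q)%N) ->
  odeco_decomposition T lam u ->
  odeco_decomposition T' lam' u' ->
  exists pi : 'S_(dmin d), forall k : 'I_(dmin d),
    `|lam k - lam' (pi k)| <= C * spectral_norm (T' - T) /\
    (lam k != 0 ->
     \big[Order.max/0]_(q < p) sin (line_angle (u q k) (u' q (pi k)))
       <= C * spectral_norm (T' - T) / lam k).
Proof.
(* 8 is the threshold of the dichotomy: below it the estimates are trivial, above it they hold with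
   3. *)
exists 8; split=> [|p d T T' lam lam' u u' p2 _]; first by apply/andP; split; lra.
move=> [eT _ lam0 ou] [eT' _ lam'0 ou'].
have p1 : (1 < p)%N by apply: ltn_trans p2.
have p0 : (0 < p)%N by apply: ltn_trans p1.
set e := spectral_norm _.
have close : contractions_close lam lam' u u' e.
  by apply: (contractions_closeP p1 ou eT eT') => x; apply: norm_tdot_outer_le.
have close' : contractions_close lam' lam u' u e.
  apply: (contractions_closeP p1 ou' eT' eT) => x x1.
  by rewrite tdotBl distrC -tdotBl; apply: norm_tdot_outer_le.
pose D := [set k | [exists l, aligned u u' k l]]%SET.
pose f k := odflt k [pick l | aligned u u' k l].
have Df k : k \in D -> aligned u u' k (f k).
  rewrite inE => /existsP[l kl]; rewrite /f; case: pickP => //= none.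
  by rewrite none in kl.
have injf : {in D &, injective f}.
  move=> k m /Df kf /Df mf km; apply: (aligned_inj p0 ou' ou).
    by rewrite -alignedC; exact: kf.
  by rewrite -alignedC km.
have [pi pif] := perm_extension injf; exists pi => k.
have e0 := close_ge0 close p0 ou k.
have big_aligned : 8 * e < Num.max (lam k) (lam' (pi k)) -> aligned u u' k (pi k).
  rewrite lt_max => /orP[ke|le].
    have kD : k \in D.
      rewrite inE; apply/existsP.
      exact: (exists_aligned p2 close close' ou ou' lam0 lam'0 ke).
    by rewrite pif //; apply: Df.
  (* When lam' (pi k) is the large value, its partner m satisfies pi m = pi k by uniqueness, hence m
     = k. *)
  have [m] := exists_aligned p2 close' close ou' ou lam'0 lam0 le.
  rewrite -alignedC => mk.
  have mD : m \in D by rewrite inE; apply/existsP; exists (pi k).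
  suff <- : m = k by rewrite pif //; apply: Df.
  by apply: (@perm_inj _ pi); rewrite pif //;
    apply: (aligned_inj p0 ou ou' (Df _ mD) mk).
split.
  case: (leP (Num.max (lam k) (lam' (pi k))) (8 * e)) => [|hm].
    rewrite ge_max ler_norml => /andP[ke le].
    by have := lam0 k; have := lam'0 (pi k) => h1 h2; apply/andP; split; lra.
  have al := big_aligned hm.
  have := aligned_lam_sub p2 close close' ou ou' lam0 lam'0 al hm.
  rewrite maxC in hm; rewrite alignedC in al.
  have := aligned_lam_sub p2 close' close ou' ou lam'0 lam0 al hm.
  by rewrite ler_norml => h1 h2; apply/andP; split; lra.
move=> lam_neq0; have lam_gt0 : 0 < lam k by rewrite lt_def lam_neq0 lam0.
(* The maximum over q starts from 0, so the bound must be nonnegative too. *)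
have e8 : 0 <= 8 * e / lam k by rewrite !mulr_ge0 ?invr_ge0 // ltW.
apply: bigmax_le => // q _; rewrite ler_pdivlMr // mulrC.
case: (leP (lam k) (8 * e)) => [ke|ke].
  by apply: le_trans ke; rewrite ler_piMr ?lam0 // sin_le1.
rewrite sin_line_angle; [|apply/norm2_eq1; by rewrite ?ou ?ou' eqxx..].
have al : aligned u u' k (pi k) by apply: big_aligned; rewrite lt_max ke.
have := aligned_sin p2 close close' ou ou' lam0 lam'0 q al ke.
by move=> /le_trans; apply; lra.
Qed.
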